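(* Let $f,g:\mathbb{R}^n\to\mathbb{R}^n$ and $\varphi:\mathbb{R}^n\to\mathbb{R}^p$ be locally Lipschitz with $f(0)=0$ and $\varphi(0)=0$. Suppose that: (H) there exist a positive definite and radially unbounded function $P\in C^2(\mathbb{R}^n;\mathbb{R}_+)$, a positive definite function $Q\in C^1(\mathbb{R}^n;\mathbb{R}_+)$ and a locally Lipschitz function $k:\mathbb{R}^n\to\mathbb{R}$ with $k(0)=0$ such that $$\nabla P(y)f(y)+\nabla P(y)g(y)k(y)\le-Q(y)\quad\text{for all }y\in\mathbb{R}^n;$$ (A) there exists a locally Lipschitz function $\mu:\mathbb{R}^n\to(0,+\infty)$ such that $|\varphi(y)|^2\le\mu(y)Q(y)$ for all $y\in\mathbb{R}^n$. Then for every $\gamma,L>0$ the system $$\dot y=f(y)+g(y)\bigl(k(y)-L\mu(y)\nabla P(y)g(y)-(\varphi(y))'z\bigr),\qquad \dot z=\gamma^{-1}\nabla P(y)g(y)\varphi(y),$$ with state $x=(y,z)\in\mathbb{R}^n\times\mathbb{R}^p$ and output $h(x)=y$, is Asymptotically Output Stable (AOS) on $\mathbb{R}^n\times\mathbb{R}^p$ and Uniformly Asymptotically Output Stable (UAOS) on $$\Omega:=\left\{x=(y,z)\in\mathbb{R}^n\times\mathbb{R}^p:\ P(y)+\frac{\gamma}{2}|z|^2\le\gamma L\right\}.$$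
   Context: $\mathbb{R}_+=[0,+\infty)$; $|\cdot|$ is the Euclidean norm; $v'$ denotes the transpose of $v$; $\nabla P(y)$ is the row vector of partial derivatives of $P$, so that $\nabla P(y)g(y)$ is a scalar. A function $P:\mathbb{R}^n\to\mathbb{R}_+$ is positive definite if $P(0)=0$ and $P(y)>0$ for $y\ne0$; a continuous $P$ is radially unbounded if for every $M>0$ the set $\{y\in\mathbb{R}^n:P(y)\le M\}$ is compact. (The system is the closed loop of $\dot y=f(y)+g(y)u+g(y)(\varphi(y))'\theta$, where $\theta\in\mathbb{R}^p$ is an unknown constant vector, with the adaptive controller $u=k(y)-(\varphi(y))'\hat\theta-L\mu(y)\nabla P(y)g(y)$, $\frac{d\hat\theta}{dt}=\gamma^{-1}\nabla P(y)g(y)\varphi(y)$, written with $z=\hat\theta-\theta$.) Output stability notions: for a system $\dot x=F(x)$ on $\mathbb{R}^N$ with solutions $\phi(t,x_0)$, output $h$, $y(t,x_0)=h(\phi(t,x_0))$, $B_R=\{x\in\mathbb{R}^N:|x|<R\}$, and $\Omega$ a positively invariant set containing $0$ (i.e. solutions starting in $\Omega$ exist for all $t\ge0$ and remain in $\Omega$), the system is: - Lagrange output stable on $\Omega$ if for every $R>0$ the set $\{|y(t,x_0)|:x_0\in B_R\cap\Omega,\ t\ge0\}$ is bounded; - Lyapunov output stable on $\Omega$ if for every $\varepsilon>0$ there exists $\delta(\varepsilon)>0$ such that for all $x_0\in B_{\delta(\varepsilon)}\cap\Omega$ it holds that $|y(t,x_0)|\le\varepsilon$ for all $t\ge0$;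 - AOS on $\Omega$ if it is Lagrange and Lyapunov output stable on $\Omega$ and $\lim_{t\to+\infty}y(t,x_0)=0$ for all $x_0\in\Omega$; - UAOS on $\Omega$ if it is Lagrange and Lyapunov output stable on $\Omega$ and for every $\varepsilon,R>0$ there exists $T(\varepsilon,R)>0$ such that for all $x_0\in B_R\cap\Omega$ it holds that $|y(t,x_0)|\le\varepsilon$ for all $t\ge T(\varepsilon,R)$. Asserting AOS (resp. UAOS) on a set includes the assertion that this set is positively invariant for the system. *)

(* Defs.v *)
From HB Require Import structures.
From mathcomp Require Import all_boot all_order all_algebra.
From mathcomp Require Import all_classical all_reals all_analysis.

Set Implicit Arguments.
Unset Strict Implicit.
Unset Printing Implicit Defensive.

Import Order.TTheory GRing.Theory Num.Theory.
Import numFieldNormedType.Exports.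

Local Open Scope classical_set_scope.
Local Open Scope ring_scope.

(* Vectors of R^n are columns ['cV[R]_n].  The library norm on matrices is the
   sup norm, so the Euclidean norm is introduced separately; topological notions
   and local Lipschitz continuity do not depend on this choice. *)
Definition enorm (R : realType) (n : nat) (v : 'cV[R]_n) : R :=
  Num.sqrt (\sum_i v i 0 ^+ 2).

Definition rcmul (R : realType) (n : nat) (u : 'rV[R]_n) (v : 'cV[R]_n) : R :=
  (u *m v) 0 0.

Definition partial_derivative (R : realType) (n : nat) (j : 'I_n)
    (P : 'cV[R]_n -> R) (y : 'cV[R]_n) : R :=
  'D_(delta_mx j 0) P y.

Definition gradient (R : realType) (n : nat) (P : 'cV[R]_n -> R)
    (y : 'cV[R]_n) : 'rV[R]_n :=
  \row_j partial_derivative j P y.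

Definition C1 (R : realType) (n : nat) (P : 'cV[R]_n -> R) : Prop :=
  (forall y : 'cV[R]_n, differentiable P y) /\ continuous (gradient P).

Definition C2 (R : realType) (n : nat) (P : 'cV[R]_n -> R) : Prop :=
  C1 P /\ forall j, C1 (partial_derivative j P).

Definition locally_lipschitz (R : realType) (V W : normedModType R)
    (f : V -> W) : Prop :=
  forall x : V, exists2 U : set V, nbhs x U & [lipschitz f y | y in U].

Definition positive_definite (R : realType) (n : nat)
    (P : 'cV[R]_n -> R) : Prop :=
  P 0 = 0 /\ forall y, y != 0 -> 0 < P y.

Definition radially_unbounded (R : realType) (n : nat)
    (P : 'cV[R]_n -> R) : Prop :=
  forall M : R, 0 < M -> compact [set y | P y <= M].

(* [x] solves x' = F(x), x(0) = x0, on [0, T), where T may be +oo.  At t = 0 only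
   continuity from the right is asked for: when F is continuous, the equation
   then holds at 0 as well, for the right derivative. *)
Definition is_solution (R : realType) (N : nat) (F : 'cV[R]_N -> 'cV[R]_N)
    (T : \bar R) (x0 : 'cV[R]_N) (x : R -> 'cV[R]_N) : Prop :=
  [/\ x 0 = x0,
      {within [set t : R | 0 <= t /\ (t%:E < T)%E], continuous x} &
      forall t : R, 0 < t -> (t%:E < T)%E -> is_derive t 1 x (F (x t))].

(* For x0 in [Omega], [phi ^~ x0] is the solution starting at x0: it exists on
   [0, +oo), and every solution from x0 on any [0, T) is a restriction of it. *)
Definition is_flow_on (R : realType) (N : nat) (F : 'cV[R]_N -> 'cV[R]_N)
    (Omega : set 'cV[R]_N) (phi : R -> 'cV[R]_N -> 'cV[R]_N) : Prop :=
  forall x0, Omega x0 ->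
    is_solution F +oo%E x0 (phi ^~ x0) /\
    forall (T : \bar R) (x : R -> 'cV[R]_N), is_solution F T x0 x ->
      forall t : R, 0 <= t -> (t%:E < T)%E -> x t = phi t x0.

(* Existence of the solutions for all t >= 0 is part of positive invariance. *)
Definition positively_invariant (R : realType) (N : nat)
    (F : 'cV[R]_N -> 'cV[R]_N) (Omega : set 'cV[R]_N)
    (phi : R -> 'cV[R]_N -> 'cV[R]_N) : Prop :=
  is_flow_on F Omega phi /\
  forall x0 t, Omega x0 -> 0 <= t -> Omega (phi t x0).

Definition eball (R : realType) (N : nat) (r : R) : set 'cV[R]_N :=
  [set x | enorm x < r].

Section OutputStability.
Context (R : realType) (N m : nat).
Variables (phi : R -> 'cV[R]_N -> 'cV[R]_N) (h : 'cV[R]_N -> 'cV[R]_m).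
Variable (Omega : set 'cV[R]_N).

Definition lagrange_output_stable : Prop :=
  forall r : R, 0 < r ->
    bounded_set [set enorm (h (phi t x0)) |
                  x0 in eball r `&` Omega & t in [set t : R | 0 <= t]].

Definition lyapunov_output_stable : Prop :=
  forall eps : R, 0 < eps -> exists2 delta : R, 0 < delta &
    forall x0, (eball delta `&` Omega) x0 ->
      forall t : R, 0 <= t -> enorm (h (phi t x0)) <= eps.

Definition output_attractive : Prop :=
  forall x0, Omega x0 -> h (phi t x0) @[t --> +oo] --> (0 : 'cV[R]_m).

Definition uniformly_output_attractive : Prop :=
  forall eps r : R, 0 < eps -> 0 < r -> exists2 T : R, 0 < T &
    forall x0, (eball r `&` Omega) x0 ->
      forall t : R, T <= t -> enorm (h (phi t x0)) <= eps.

End OutputStability.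

(* The flow is determined on [Omega] and nonnegative times by
   [positively_invariant], so the existential only names it. *)
Definition AOS (R : realType) (N m : nat) (F : 'cV[R]_N -> 'cV[R]_N)
    (h : 'cV[R]_N -> 'cV[R]_m) (Omega : set 'cV[R]_N) : Prop :=
  exists phi : R -> 'cV[R]_N -> 'cV[R]_N,
    [/\ Omega 0, positively_invariant F Omega phi,
        lagrange_output_stable phi h Omega,
        lyapunov_output_stable phi h Omega &
        output_attractive phi h Omega].

Definition UAOS (R : realType) (N m : nat) (F : 'cV[R]_N -> 'cV[R]_N)
    (h : 'cV[R]_N -> 'cV[R]_m) (Omega : set 'cV[R]_N) : Prop :=
  exists phi : R -> 'cV[R]_N -> 'cV[R]_N,
    [/\ Omega 0, positively_invariant F Omega phi,
        lagrange_output_stable phi h Omega,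
        lyapunov_output_stable phi h Omega &
        uniformly_output_attractive phi h Omega].

(* The state x = (y, z) is the column [col_mx y z], with y = [usubmx x] and
   z = [dsubmx x]. *)
Definition closed_loop (R : realType) (n p : nat)
    (f g : 'cV[R]_n -> 'cV[R]_n) (varphi : 'cV[R]_n -> 'cV[R]_p)
    (P k mu : 'cV[R]_n -> R) (gamma L : R) (x : 'cV[R]_(n + p)) :
    'cV[R]_(n + p) :=
  let y := usubmx x in
  let z := dsubmx x in
  let w := rcmul (gradient P y) (g y) in
  col_mx (f y + (k y - L * mu y * w - rcmul (varphi y)^T z) *: g y)
         ((gamma^-1 * w) *: varphi y).

(* Main.v *)
Require Import Defs.
From HB Require Import structures.
From mathcomp Require Import all_boot all_order all_algebra.
From mathcomp Require Import all_classical all_reals all_analysis.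
From mathcomp Require Import ring lra.

Set Implicit Arguments.
Unset Strict Implicit.
Unset Printing Implicit Defensive.

Import Order.TTheory GRing.Theory Num.Theory.
Import numFieldNormedType.Exports.
Local Open Scope classical_set_scope.
Local Open Scope ring_scope.

(* Along the closed loop, V(y, z) = P(y) + gamma |z|^2 / 2 satisfies
   dV/dt <= - Q(y).  Hence solutions stay in compact sublevel sets of V, exist
   globally, and P(y) <= V gives Lagrange and Lyapunov output stability.  Since
   the output is Lipschitz in time, V would drop by a fixed amount infinitely
   often if y did not tend to 0.  On Omega one has |z|^2 <= 2 L, so Young's
   inequality absorbs the term containing z into the damping - L mu w^2, where
   w = grad P . g, and into Q / 2; thus dP/dt <= - Q(y) / 2, which makes the
   convergence uniform.

   Solutions are obtained as ultrafilter limits of explicit Euler schemes, which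
   needs neither integrals nor a convergence estimate. *)

(** * Entries of a matrix against its sup norm, and compactness of closed balls *)

Section CompactBalls.
Context {R : realType}.

Lemma mx_coord_le m n (A : 'M[R]_(m, n)) i j : `|A i j| <= `|A|.
Proof.
by rewrite [leRHS]/Num.norm /= mx_normrE; exact: (le_bigmax _ _ (i, j)).
Qed.

Lemma mx_norm_le m n (A : 'M[R]_(m, n)) (c : R) :
  0 <= c -> (forall i j, `|A i j| <= c) -> `|A| <= c.
Proof.
move=> c0 Ac; rewrite [leLHS]/Num.norm /= mx_normrE.
by apply/bigmax_leP; split => // -[i j] _; exact: Ac.
Qed.

Lemma normmx_tr m n (A : 'M[R]_(m, n)) : `|A^T| = `|A|.
Proof.
apply/eqP; rewrite eq_le; apply/andP; split; apply: mx_norm_le => // i j.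
  by rewrite mxE mx_coord_le.
by have := mx_coord_le A^T j i; rewrite mxE.
Qed.

(** Transposition is an isometry, so the ball is the continuous image of the corresponding ball of
    row vectors, which is compact because it is bounded and closed. *)
Lemma compact_closed_ball_cV n (r : R) : compact [set v : 'cV[R]_n | `|v| <= r].
Proof.
have -> : [set v : 'cV[R]_n | `|v| <= r] = trmx @` [set v : 'rV[R]_n | `|v| <= r].
  apply/seteqP; split => [v /= vr|_ /= [v vr <-]]; last by rewrite normmx_tr.
  by exists v^T; rewrite ?normmx_tr ?trmxK.
apply: continuous_compact.
  apply: continuous_subspaceT => v; apply/(@cvgrPdist_le _ _ _ (nbhs v)) => e e0.
  near=> w; rewrite -linearB normmx_tr; near: w.
  have := nbhsx_ballx v e e0; apply: filterS => w.
  by rewrite -ball_normE /= => /ltW.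
apply: bounded_closed_compact.
  exists r; split; first exact: num_real.
  by move=> x rx v /= vr; rewrite (le_trans vr)// ltW.
rewrite (_ : [set v : 'rV[R]_n | `|v| <= r] = Num.norm @^-1` [set x : R | x <= r])//.
by apply: closed_comp => // v _; exact: norm_continuous.
Unshelve. all: by end_near. Qed.

End CompactBalls.

(** * Existence of solutions for bounded continuous fields, by explicit Euler schemes *)

Section EulerScheme.
Context {R : realType} {N : nat}.
Implicit Types (G : 'cV[R]_N -> 'cV[R]_N).

Definition euler G (h : R) (x0 : 'cV[R]_N) k := iter k (fun x => x + h *: G x) x0.

(** Discrete mean value inequality: each of the [k - j] steps differs from [h *: w] by at most
    [h * e], and the errors add up. *)
Lemma euler_dist G (h : R) x0 (w : 'cV[R]_N) (e : R) (j k : nat) :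
  0 <= h -> (j <= k)%N ->
  (forall i, (j <= i < k)%N -> `|G (euler G h x0 i) - w| <= e) ->
  `|euler G h x0 k - euler G h x0 j - (h * (k - j)%:R) *: w|
    <= h * (k - j)%:R * e.
Proof.
move=> h0 /subnKC <-; elim: (k - j)%N => [|m ih] Gw.
  by rewrite addn0 subnn mulr0 scale0r subrr subr0 normr0 mul0r.
have {}ih := ih _; rewrite !addKn in ih *.
rewrite addnS /= -/(euler _ _ _ _).
set y := euler _ _ _ (_ + _); set z := euler _ _ _ _.
have -> : y + h *: G y - z - (h * m.+1%:R) *: w =
    (y - z - (h * m%:R) *: w) + h *: (G y - w).
  by rewrite -[m.+1]addn1 natrD mulrDr mulr1 scalerDl scalerBr; 
     apply/matrixP => a b; rewrite !mxE; ring.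
apply: le_trans (ler_normD _ _) _.
rewrite -[m.+1]addn1 natrD mulrDr mulr1 mulrDl lerD//.
  apply: ih => i /andP[ji im]; apply: Gw; rewrite ji addnS ltnS ltnW//.
rewrite normrZ ger0_norm// ler_wpM2l// Gw// leq_addr addnS ltnSn//.
Qed.

Lemma truncn_dist (t : R) (n : nat) : 0 <= t ->
  `|n.+1%:R^-1 * (Num.truncn (t * n.+1%:R))%:R - t| <= n.+1%:R^-1.
Proof.
move=> t0; have n0 : (0 : R) < n.+1%:R by rewrite ltr0n.
have /andP[] := @truncn_itv R (t * n.+1%:R) (mulr_ge0 t0 (ltW n0)).
set k := (Num.truncn _); rewrite -[k.+1]addn1 natrD => a b.
have -> : n.+1%:R^-1 * k%:R - t = n.+1%:R^-1 * (k%:R - t * n.+1%:R).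
  by field; rewrite addrC -natr1 gt_eqF in n0 *.
have h0 : (0 : R) <= n.+1%:R^-1 by rewrite invr_ge0 ltW.
rewrite normrM (ger0_norm h0) -[leRHS]mulr1 ler_wpM2l//.
by rewrite ler_norml; apply/andP; split; lra.
Qed.


Lemma euler_lip G (h : R) x0 (M : R) (j k : nat) :
  0 <= h -> (forall x, `|G x| <= M) -> (j <= k)%N ->
  `|euler G h x0 k - euler G h x0 j| <= h * (k - j)%:R * M.
Proof.
move=> h0 GM jk; have := @euler_dist G h x0 0 M j k h0 jk.
by rewrite scaler0 subr0; apply => i _; rewrite subr0.
Qed.

(** Compactness of the ball yields a cluster point of the image of [U], and an ultrafilter converges
    to its cluster points. *)
Lemma ultra_bounded_cvg (U : set_system nat) (UU : UltraFilter U)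
    (u : nat -> 'cV[R]_N) (r : R) :
  (forall n, `|u n| <= r) -> exists l : 'cV[R]_N, u n @[n --> U] --> l.
Proof.
move=> ur; have UP : ProperFilter U by exact: ultra_proper.
have [|l [_ cl]] := @compact_closed_ball_cV R N r (u @ U) _.
  by apply: (@filterE _ U) => n; exact: ur.
exists l => A lA; have [//|UA] := in_ultra_setVsetC (u @^-1` A) UU.
by have [y []] := cl (~` A) A UA lA.
Qed.

(** First-order expansion, the form in which the Euler estimates deliver a derivative. *)
Lemma is_derive_dist (V : normedModType R) (x : R -> V) (t : R) (v : V) :
  (forall e, 0 < e -> exists2 d, 0 < d & forall s, `|s - t| < d ->
     `|x s - x t - (s - t) *: v| <= e * `|s - t|) ->
  is_derive t 1 x v.
Proof.
move=> H.
have cv : (fun h : R => h^-1 *: ((x \o shift t) (h *: (1:R)) - x t)) @ 0^' --> v.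
  apply/cvgrPdist_le => e e0; have [d d0 Hd] := H e e0.
  near=> h.
  have h0 : h != 0 by near: h; exact: nbhs_dnbhs_neq.
  have hd : `|h| < d by near: h; exact: dnbhs0_lt.
  have -> : v - h^-1 *: ((x \o shift t) (h *: (1:R)) - x t) =
      - (h^-1 *: (x (h + t) - x t - h *: v)).
    by rewrite /= [h *: 1]mulr1 [in RHS]scalerBr scalerA mulVf// scale1r opprB.
  rewrite normrN normrZ normfV ler_pdivrMl ?normr_gt0// mulrC.
  by have := Hd (h + t); rewrite addrK; apply.
split; first by apply/cvg_ex; exists v.
exact: cvg_lim.
Unshelve. all: by end_near. Qed.


Lemma truncn_cvg (t : R) : 0 <= t ->
  n.+1%:R^-1 * (Num.truncn (t * n.+1%:R))%:R @[n --> \oo] --> t.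
Proof.
move=> t0; apply/cvgrPdist_le => e e0.
have /cvgrPdist_le /(_ e e0) := @cvg_harmonic R.
apply: filterS => n /=; rewrite sub0r normrN ger0_norm ?invr_ge0// => he.
by rewrite distrC (le_trans (truncn_dist n t0)).
Qed.

(** Peano's theorem. At each time the Euler approximations are bounded, so they converge along an
    ultrafilter; the uniform Euler estimates survive in the limit and give both continuity and the
    differential equation. *)
Theorem bounded_field_solution G (M : R) (x0 : 'cV[R]_N) :
  continuous G -> (forall x, `|G x| <= M) ->
  exists x : R -> 'cV[R]_N, is_solution G +oo%E x0 x.
Proof.
move=> Gc GM; have M0 : 0 <= M := le_trans (normr_ge0 _) (GM 0).
(* A single ultrafilter serves all times, so that estimates relating two times pass to the limit. It
   refines [\oo], hence keeps ordinary limits. *)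
have [U [UU sU]] := ultraFilterLemma eventually_filter.
have UP : ProperFilter U by exact: ultra_proper.
have cvU (u : nat -> R) (l : R) : u @ \oo --> l -> u @ U --> l.
  by move=> ul A /ul /sU.
(* [X n t] is the last Euler node not later than [t], for the step [1 / (n + 1)]. *)
pose k (t : R) n := Num.truncn (t * n.+1%:R).
pose E n := euler G n.+1%:R^-1 x0.
pose X n t := E n (k t n).
have h0 n : (0 : R) <= n.+1%:R^-1 by rewrite invr_ge0.
have hk_le t n : 0 <= t -> n.+1%:R^-1 * (k t n)%:R <= t.
  move=> t0; rewrite ler_pdivrMl ?ltr0n// mulrC.
  by have /andP[] := truncn_itv (mulr_ge0 t0 (ler0n R n.+1)).
have k_le a b n : a <= b -> (k a n <= k b n)%N.
  by move=> ab; apply: le_truncn; rewrite ler_wpM2r.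
have X_bd n t : 0 <= t -> `|X n t| <= `|x0| + t * M.
  move=> t0; rewrite -[X n t](subrK x0) addrC (le_trans (ler_normD _ _))// lerD2l.
  apply: le_trans (euler_lip x0 (h0 n) GM (leq0n _)) _.
  by rewrite subn0 ler_wpM2r// hk_le.
(* At negative times the limit is unconstrained and [0] is a dummy value. *)
have /choice[x xP] t : exists l : 'cV[R]_N, 0 <= t -> X n t @[n --> U] --> l.
  have [t0|] := leP 0 t; last by exists 0.
  have [l Xl] := ultra_bounded_cvg UU (fun n => X_bd n _ t0).
  by exists l.
have hkb a b : 0 <= a <= b ->
    n.+1%:R^-1 * (k b n - k a n)%:R @[n --> U] --> b - a.
  move=> /andP[a0 ab].
  suff H : n.+1%:R^-1 * (k b n - k a n)%:R @[n --> \oo] --> b - a by exact: cvU H.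
  rewrite (_ : (fun _ => _) = (fun n => n.+1%:R^-1 * (k b n)%:R)
                            - (fun n => n.+1%:R^-1 * (k a n)%:R)).
    by apply: cvgB; apply: truncn_cvg => //; exact: le_trans ab.
  by apply/funext => n; rewrite natrB ?k_le// mulrBr.
(* The limit form of [euler_dist]: [w = 0], [e = M] will give the Lipschitz bound, and [w = G (x s)]
   the derivative at [s]. *)
have key a b w e : 0 <= a <= b ->
    (\forall n \near U, forall i, (k a n <= i < k b n)%N ->
       `|G (E n i) - w| <= e) ->
    `|x b - x a - (b - a) *: w| <= (b - a) * e.
  move=> /[dup] ab0 /andP[a0 ab] Gw; have b0 := le_trans a0 ab.
  have L1 : `|X n b - X n a - (n.+1%:R^-1 * (k b n - k a n)%:R) *: w| @[n --> U]
      --> `|x b - x a - (b - a) *: w|.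
    apply: cvg_norm; apply: cvgB; last by apply: cvgZr_tmp; exact: hkb.
    by apply: cvgB; exact: xP.
  have L2 : n.+1%:R^-1 * (k b n - k a n)%:R * e @[n --> U] --> (b - a) * e.
    by apply: cvgMr_tmp; exact: hkb.
  apply: ler_cvg_to L1 L2 _.
  by apply: filterS Gw => n Gw; apply: euler_dist => //; exact: k_le.
have xlip a b : 0 <= a <= b -> `|x b - x a| <= (b - a) * M.
  move=> ab; have := key a b 0 M ab; rewrite scaler0 subr0; apply.
  by apply: filterE => n i _; rewrite subr0.
have xlip' a b : 0 <= a -> 0 <= b -> `|x b - x a| <= `|b - a| * M.
  move=> a0 b0; have [ab|/ltW ba] := leP a b.
    by rewrite ger0_norm ?subr_ge0//; apply: xlip; rewrite a0.
  by rewrite distrC (distrC b) ger0_norm ?subr_ge0//; apply: xlip; rewrite b0.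
exists x; split.
- have := xP 0 (lexx 0); have -> : X ^~ 0 = cst x0.
    by apply/funext => n; rewrite /X /k mul0r truncn0.
  by move=> /(cvg_unique _ (cvg_cst _)) ->.
- apply/subspace_continuousP => s [s0 _]; apply/cvgrPdist_le => e e0.
  rewrite near_withinE; near=> r => -[r0 _].
  rewrite (le_trans (xlip' _ _ r0 s0))//.
  rewrite (@le_trans _ _ (e / (M + 1) * (M + 1)))//; last first.
    by rewrite divfK// gt_eqF// ltr_wpDl.
  apply: ler_pM => //; last by rewrite lerDl.
  near: r; apply: (@cvgr_dist_le _ _ _ _ _ id) => //.
  by rewrite divr_gt0// ltr_wpDl.
move=> s s0 _; apply: is_derive_dist => e e0.
have /cvgrPdist_le /(_ e e0) := Gc (x s).
rewrite -filter_from_ballE /= => -[d /= d0 Gd].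
have M1 : 0 < M + 1 by rewrite ltr_wpDl.
have d4 : 0 < d / (4 * (M + 1)) by rewrite divr_gt0// mulr_gt0.
(* The bound [s] keeps [t] nonnegative. As the speed is at most [M], the other bound keeps the nodes
   between [s] and [t] within [d / 4] of [X n s], hence within [3 d / 8] of [x s], for most [n]. *)
exists (Num.min s (d / (4 * (M + 1)))); first by rewrite lt_min s0 d4.
move=> t; rewrite lt_min => /andP[ts td].
have t0 : 0 <= t by move: ts; rewrite ltr_norml => /andP[]; lra.
(* Left and right increments are treated together, [s] being either endpoint. *)
suff H a b : 0 <= a <= b -> b - a < d / (4 * (M + 1)) -> s = a \/ s = b ->
    `|x b - x a - (b - a) *: G (x s)| <= (b - a) * e.
  have [st|/ltW st] := leP s t.
    rewrite ger0_norm ?subr_ge0// in td *.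
    by rewrite [e * _]mulrC; apply: H => //; [rewrite (ltW s0)|left].
  rewrite distrC ger0_norm ?subr_ge0// in td *.
  have := H t s; rewrite t0 st => /(_ isT td (or_intror erefl)).
  rewrite [e * _]mulrC; congr (_ <= _).
  rewrite -normrN; congr (`|_|); apply/matrixP => i j; rewrite !mxE; ring.
move=> ab bad sab; apply: key => //.
have near1 : \forall n \near U, `|x s - X n s| <= d / 8.
  by apply: cvgr_dist_le; [exact: xP (ltW s0)|rewrite divr_gt0].
have near2 : \forall n \near U,
    n.+1%:R^-1 * (k b n - k a n)%:R < d / (4 * (M + 1)).
  by apply: (cvgr_lt (b - a)) => //; exact: hkb.
near=> n => i /andP[ai ib].
rewrite distrC; apply: Gd; rewrite -ball_normE /=.
have H1 : `|x s - X n s| <= d / 8 by near: n.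
have H2 : n.+1%:R^-1 * (k b n - k a n)%:R < d / (4 * (M + 1)) by near: n.
have H3 : `|X n s - E n i| <= n.+1%:R^-1 * (k b n - k a n)%:R * M.
  case: sab => ->.
    rewrite distrC (le_trans (euler_lip x0 (h0 n) GM ai))//.
    by rewrite ler_wpM2r// ler_wpM2l// ler_nat leq_sub2r// ltnW.
  rewrite (le_trans (euler_lip x0 (h0 n) GM (ltnW ib)))//.
  by rewrite ler_wpM2r// ler_wpM2l// ler_nat leq_sub2l.
have H4 : n.+1%:R^-1 * (k b n - k a n)%:R * M <= d / 4.
  apply: (@le_trans _ _ (d / (4 * (M + 1)) * (M + 1))).
    by apply: ler_pM; rewrite ?(ltW H2) ?lerDl ?mulr_ge0.
  by rewrite invfM mulrA divfK ?gt_eqF.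
have -> : x s - E n i = (x s - X n s) + (X n s - E n i) by rewrite addrA subrK.
apply: le_lt_trans (ler_normD _ _) _.
apply: le_lt_trans (lerD H1 (le_trans H3 H4)) _.
by move: d0; rewrite /=; clear; lra.
Unshelve. all: by end_near. Qed.

End EulerScheme.

(** * Mean value inequality and uniqueness of solutions for locally Lipschitz fields *)

Section Solutions.
Context {R : realType}.

Lemma locally_lipschitzP (V W : normedModType R) (f : V -> W) :
  locally_lipschitz f <-> forall x, exists d k : R,
    [/\ 0 < d, 0 <= k & forall y z, `|y - x| < d -> `|z - x| < d ->
      `|f y - f z| <= k * `|y - z|].
Proof.
split=> [fl x|fl x].
  have [U] := fl x; rewrite -nbhs_ballE => -[d /= d0 dU] [M [_ fM]].
  (* The Lipschitz bound is available for every constant strictly above [M]; this one is also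
     nonnegative. *)
  exists d, (`|M| + 1); split => // y z yd zd.
  apply: (fM (`|M| + 1) _ (y, z)); last split; first by rewrite (le_lt_trans (ler_norm _))// ltrDl.
    by apply: dU; rewrite -ball_normE /= distrC.
  by apply: dU; rewrite -ball_normE /= distrC.
have [d [k [d0 k0 fk]]] := fl x.
exists (ball x d); first exact: nbhsx_ballx.
exists k; split; first exact: num_real.
move=> M kM [y z] /= []; rewrite -ball_normE /= => xy xz.
rewrite (le_trans (fk _ _ _ _))// 1?distrC//.
by rewrite ler_wpM2r// ltW.
Qed.

Lemma within_continuousB (V W : normedModType R) (A : set V) (f g : V -> W) :
  {within A, continuous f} -> {within A, continuous g} ->
  {within A, continuous (f - g)}.
Proof.
move=> /subspace_continuousP fc /subspace_continuousP gc.
by apply/subspace_continuousP => t At; apply: cvgB; [exact: fc|exact: gc].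
Qed.

(** The scalar mean value theorem applies to each entry, at a point depending on the entry; this
    suffices because the norm is the sup norm. *)
Lemma mean_value_mx m n (x dx : R -> 'M[R]_(m, n)) (a b c : R) : a <= b ->
  {within `[a, b], continuous x} ->
  (forall t, t \in `]a, b[ -> is_derive t 1 x (dx t)) ->
  (forall t, t \in `]a, b[ -> `|dx t| <= c) ->
  `|x b - x a| <= c * (b - a).
Proof.
move=> ab xc xd dxc; move: ab; rewrite le_eqVlt => /predU1P[<-|ab].
  by rewrite !subrr normr0 mulr0.
have c0 : 0 <= c.
  by apply: le_trans (normr_ge0 _) (dxc ((a + b) / 2) _); exact: mid_in_itvoo.
apply: mx_norm_le => [|i j]; first by rewrite mulr_ge0// subr_ge0 ltW.
have xcij : {within `[a, b], continuous (fun t => x t i j)}.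
  move=> t; apply: (@continuous_comp _ _ _ (x : subspace `[a, b] -> _)
                      (fun M : 'M[R]_(m, n) => M i j)).
    exact: xc.
  exact: coord_continuous.
have xdij t : t \in `]a, b[%R -> is_derive t 1 (fun t => x t i j) (dx t i j).
  move=> tab; have [xt <-] := xd t tab.
  split; first by move/derivable_mxP : xt.
  by rewrite (derive_mx xt) mxE.
have [t tab] := MVT ab xdij xcij; rewrite !mxE => ->.
rewrite normrM (@ger0_norm _ (b - a)) ?subr_ge0 ?(ltW ab)//.
by rewrite ler_wpM2r ?subr_ge0 ?(ltW ab)// (le_trans (mx_coord_le _ _ _))// dxc.
Qed.

Variable N : nat.
Implicit Types (F : 'cV[R]_N -> 'cV[R]_N).

Lemma solution_within F (T : \bar R) x0 x (a b : R) : is_solution F T x0 x ->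
  0 <= a -> (b%:E < T)%E -> {within `[a, b], continuous x}.
Proof.
move=> [_ xc _] a0 bT; apply: continuous_subspaceW xc => t /=.
rewrite in_itv /= => /andP[ta tb]; split; first exact: le_trans ta.
by rewrite (le_lt_trans _ bT)// lee_fin.
Qed.

Lemma solution_derive F (T : \bar R) x0 x (a b : R) : is_solution F T x0 x ->
  0 <= a -> (b%:E < T)%E -> forall t, t \in `]a, b[ -> is_derive t 1 x (F (x t)).
Proof.
move=> [_ _ xd] a0 bT t; rewrite in_itv /= => /andP[ta tb].
by apply: xd; [exact: le_lt_trans ta|rewrite (le_lt_trans _ bT)// lee_fin ltW].
Qed.

(* On a short interval the maximum of [|x - y|] is at most half of itself. *)
Lemma solution_unique_local F (T : \bar R) x0 y0 x y (s : R) :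
  locally_lipschitz F -> is_solution F T x0 x -> is_solution F T y0 y ->
  0 <= s -> x s = y s -> forall t1, s < t1 -> (t1%:E < T)%E ->
  exists2 b, s < b <= t1 & forall t, s <= t <= b -> x t = y t.
Proof.
move=> /locally_lipschitzP Fl xs ys s0 xys t1 st1 t1T.
have [d [k [d0 k0 Fk]]] := Fl (x s).
have near_s z z0 : is_solution F T z0 z -> exists2 e, 0 < e &
    forall t, s <= t <= t1 -> t - s < e -> `|z t - z s| < d.
  move=> zs; have /subspace_continuousP zc := solution_within zs s0 t1T.
  have /zc : `[s, t1]%classic s by rewrite /= in_itv /= lexx ltW.
  move/cvgrPdist_lt => /(_ d d0); rewrite near_withinE -nbhs_ballE => -[e /= e0 H].
  exists e => // t /andP[st tt1] te; rewrite distrC; apply: H => /=.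
    by rewrite -ball_normE /= distrC ger0_norm ?subr_ge0.
  by rewrite in_itv /= st.
have [e1 e10 xd] := near_s _ _ xs; have [e2 e20 yd] := near_s _ _ ys.
have k1 : 0 < 2 * (k + 1) by rewrite mulr_gt0// ltr_wpDl.
have e30 : 0 < (2 * (k + 1))^-1 by rewrite invr_gt0.
(* The halves keep both solutions in the ball where [F] is [k]-Lipschitz; the last term makes the
   contraction factor [k * m] at most [1 / 2]. *)
pose m := Num.min (e1 / 2) (Num.min (e2 / 2) (2 * (k + 1))^-1).
have m0 : 0 < m by rewrite !lt_min e30 !divr_gt0.
have [me1 me2 me3] : [/\ m <= e1 / 2, m <= e2 / 2 & m <= (2 * (k + 1))^-1].
  by rewrite /m !ge_min !lexx !orbT.
pose b := Num.min t1 (s + m).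
have sb : s < b by rewrite lt_min st1 ltrDl.
have [bt1 bm] : b <= t1 /\ b - s <= m.
  by split; rewrite ?lerBlDl ge_min lexx ?orbT.
have bT : (b%:E < T)%E by rewrite (le_lt_trans _ t1T)// lee_fin.
exists b; first by rewrite sb.
have xc := solution_within xs s0 bT; have yc := solution_within ys s0 bT.
have zc : {within `[s, b], continuous (x - y)}.
  exact: within_continuousB.
have nc : {within `[s, b], continuous (fun t => `|(x - y) t|)}.
  move/subspace_continuousP : zc => zc.
  by apply/subspace_continuousP => t tb; apply: cvg_norm; exact: zc.
have [r rsb rmax] := EVT_max (ltW sb) nc.
have /andP[sr rb] : s <= r <= b by move: rsb; rewrite in_itv.
have D0 : (x - y) s = 0 by rewrite !fctE xys subrr.
have Dr : `|(x - y) r| <= k * `|(x - y) r| * (r - s).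
  have -> : `|(x - y) r| = `|(x - y) r - (x - y) s| by rewrite D0 subr0.
  apply: (mean_value_mx (dx := fun t => F (x t) - F (y t))) => //.
  - apply: continuous_subspaceW zc; apply: subset_itvl; rewrite bnd_simp//.
  - move=> t; rewrite in_itv /= => /andP[st tr].
    have tsb : t \in `]s, b[ by rewrite in_itv /= st (lt_le_trans tr).
    have := solution_derive xs s0 bT tsb; have := solution_derive ys s0 bT tsb.
    by move=> ? ?; exact: is_deriveB.
  move=> t; rewrite in_itv /= => /andP[st tr].
  have tb : t <= b by rewrite ltW// (lt_le_trans tr).
  have tt1 : s <= t <= t1 by rewrite ltW// (le_trans tb).
  have -> : (x - y) r - (x - y) s = (x - y) r.
    by rewrite D0 subr0.
  apply: (@le_trans _ _ (k * `|x t - y t|)).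
    by apply: Fk; rewrite ?xys -?xys; [apply: xd|rewrite xys; apply: yd] => //; lra.
  by rewrite ler_wpM2l//; apply: rmax; rewrite in_itv /= tb ltW.
have /eqP : `|(x - y) r| = 0.
  apply/eqP; rewrite eq_le normr_ge0 andbT.
  have : k * `|(x - y) r| * (r - s) <= k * `|(x - y) r| * (2 * (k + 1))^-1.
    by rewrite ler_wpM2l ?mulr_ge0//; lra.
  move=> /(le_trans Dr); rewrite mulrAC.
  have : k * (2 * (k + 1))^-1 <= 1 / 2.
    by rewrite ler_pdivrMr//; lra.
  move=> H1 H2; have := ler_wpM2r (normr_ge0 ((x - y) r)) H1; lra.
rewrite normr_eq0 => /eqP Dr0 t tsb.
have := rmax t; rewrite in_itv /= Dr0 normr0 => /(_ tsb).
by rewrite normr_le0 => /eqP /subr0_eq.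
Qed.

(** Let [s] be the supremum of the times up to which the solutions agree. Continuity extends the
    agreement to [s], and local uniqueness would carry it past [s] if [s < t1]. *)
Theorem solution_unique F (T : \bar R) x0 x y :
  locally_lipschitz F -> is_solution F T x0 x -> is_solution F T x0 y ->
  forall t, 0 <= t -> (t%:E < T)%E -> x t = y t.
Proof.
move=> Fl xs ys t1 t10 t1T.
have [//|/eqP xy1] := eqVneq (x t1) (y t1).
pose A := [set t | 0 <= t <= t1 /\ forall r, 0 <= r <= t -> x r = y r].
have xy0 : x 0 = y 0 by case: xs => ->; case: ys => ->.
have A0 : A 0.
  by split=> [|r /le_anti <-//]; rewrite lexx.
have At1 : ubound A t1 by move=> t [/andP[]].
have supA : has_sup A by split; [exists 0|exists t1].
pose s := sup A.
have s0 : 0 <= s by apply: ub_le_sup => //; exists t1.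
have st1 : s <= t1 by apply: ge_sup => //; exists 0.
have xyr r : 0 <= r -> r < s -> x r = y r.
  move=> r0 /sup_gt[|t [_ At] rt]; first by exists 0.
  by apply: At; rewrite r0 ltW.
have xys : x s = y s.
  have [s0'|] := ltP 0 s; last by move=> s0'; rewrite (_ : s = 0)//; apply/le_anti; rewrite s0' s0.
  have xc := solution_within xs (lexx 0) t1T; have yc := solution_within ys (lexx 0) t1T.
  have /subspace_continuousP /(_ s) : {within `[0, t1], continuous (x - y)}.
    exact: within_continuousB.
  rewrite /= in_itv /= s0 st1 => /(_ isT) /cvgrPdist_lt H.
  apply/eqP; rewrite -subr_eq0 -normr_le0 leNgt; apply/negP => /H.
  rewrite near_withinE -nbhs_ballE => -[d /= d0].
  (* A point of [[0, s)] closer than [d] to [s]: the solutions agree there, which is incompatible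
     with a gap at [s]. *)
  pose p := Num.max 0 (s - d / 2).
  have rs : p < s by rewrite gt_max s0'/= gtrBl divr_gt0.
  have r0 : 0 <= p by rewrite le_max lexx.
  have ps : s - d < p by rewrite lt_max; apply/orP; right; move: d0; clear; lra.
  move=> /(_ p); rewrite -ball_normE /= in_itv /= r0 (le_trans (ltW rs) st1).
  rewrite ger0_norm ?subr_ge0 ?(ltW rs)// ltrBlDl -ltrBlDr ps => /(_ isT isT).
  by rewrite /from_subspace !fctE (xyr p)// subrr subr0 ltxx.
move: st1; rewrite le_eqVlt => /predU1P[<-//|st1].
have [b /andP[sb bt1] xyb] := solution_unique_local Fl xs ys s0 xys st1 t1T.
suff : b <= s by rewrite leNgt sb.
apply: ub_le_sup; first by exists t1.
split=> [|r /andP[r0 rb]]; first by rewrite bt1 (le_trans s0 (ltW sb)).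
have [rs|sr] := ltP r s; first exact: xyr.
by apply: xyb; rewrite sr.
Qed.

End Solutions.

(** * Closure properties of locally Lipschitz maps *)

Section LocallyLipschitz.
Context {R : realType}.
Implicit Types (U V W : normedModType R).

Lemma locally_lipschitz_continuous V W (f : V -> W) :
  locally_lipschitz f -> continuous f.
Proof.
move=> /locally_lipschitzP fl x; apply/cvgrPdist_lt => e e0.
have [d [k [d0 k0 fk]]] := fl x.
have k1 : 0 < k + 1 by rewrite ltr_wpDl.
apply/nbhs_ballP; exists (Num.min d (e / (k + 1))).
  by rewrite /= lt_min d0 divr_gt0.
move=> y; rewrite -ball_normE /= lt_min => /andP[xd xe].
have := fk x y; rewrite subrr normr0 distrC => /(_ d0 xd) /le_lt_trans; apply.
apply: (@le_lt_trans _ _ ((k + 1) * `|x - y|)); first by rewrite ler_wpM2r ?lerDl.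
by rewrite mulrC -ltr_pdivlMr.
Qed.

Lemma locally_lipschitz_cst V W (c : W) : locally_lipschitz (fun _ : V => c).
Proof.
apply/locally_lipschitzP => x; exists 1, 0; split=> // y z _ _.
by rewrite subrr normr0 mul0r.
Qed.

Lemma locally_lipschitz_comp U V W (g : V -> W) (f : U -> V) :
  locally_lipschitz g -> locally_lipschitz f ->
  locally_lipschitz (fun x => g (f x)).
Proof.
move=> /locally_lipschitzP gl fl; apply/locally_lipschitzP => x.
have fc := locally_lipschitz_continuous fl.
move/locally_lipschitzP : fl => /(_ x) [d [k [d0 k0 fk]]].
have [d' [k' [d'0 k'0 gk]]] := gl (f x).
have /cvgrPdist_lt /(_ d' d'0) := fc x; move=> /nbhs_ballP[e /= e0 fe].
exists (Num.min d e), (k' * k); split.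
- by rewrite lt_min d0.
- exact: mulr_ge0.
move=> y z; rewrite !lt_min => /andP[yd ye] /andP[zd ze].
rewrite -mulrA; apply: le_trans (gk _ _ _ _) _.
- by rewrite distrC; apply: fe; rewrite -ball_normE /= distrC.
- by rewrite distrC; apply: fe; rewrite -ball_normE /= distrC.
by rewrite ler_wpM2l// fk.
Qed.

Lemma locally_lipschitzD V W (f g : V -> W) :
  locally_lipschitz f -> locally_lipschitz g ->
  locally_lipschitz (fun x => f x + g x).
Proof.
move=> /locally_lipschitzP fl /locally_lipschitzP gl.
apply/locally_lipschitzP => x.
have [d [k [d0 k0 fk]]] := fl x; have [d' [k' [d'0 k'0 gk]]] := gl x.
exists (Num.min d d'), (k + k'); split.
- by rewrite lt_min d0.
- exact: addr_ge0.
move=> y z; rewrite !lt_min => /andP[yd ye] /andP[zd ze].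
rewrite opprD addrACA (le_trans (ler_normD _ _))// mulrDl.
by apply: lerD; [exact: fk|exact: gk].
Qed.

Lemma locally_lipschitzN V W (f : V -> W) :
  locally_lipschitz f -> locally_lipschitz (fun x => - f x).
Proof.
move=> /locally_lipschitzP fl; apply/locally_lipschitzP => x.
have [d [k [d0 k0 fk]]] := fl x; exists d, k; split=> // y z yd zd.
by rewrite -opprD normrN fk.
Qed.

Lemma locally_lipschitzM V (f g : V -> R) :
  locally_lipschitz f -> locally_lipschitz g ->
  locally_lipschitz (fun x => f x * g x).
Proof.
move=> /locally_lipschitzP fl /locally_lipschitzP gl.
apply/locally_lipschitzP => x.
have [d [k [d0 k0 fk]]] := fl x; have [d' [k' [d'0 k'0 gk]]] := gl x.
pose A := `|f x| + k * d; pose B := `|g x| + k' * d'.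
have A0 : 0 <= A by rewrite addr_ge0// mulr_ge0// ltW.
have B0 : 0 <= B by rewrite addr_ge0// mulr_ge0// ltW.
exists (Num.min d d'), (A * k' + B * k); split.
- by rewrite lt_min d0.
- by rewrite addr_ge0// mulr_ge0.
move=> y z; rewrite !lt_min => /andP[yd ye] /andP[zd ze].
have fA : `|f y| <= A.
  rewrite -[f y](subrK (f x)) addrC (le_trans (ler_normD _ _))// lerD2l.
  by rewrite (le_trans (fk _ _ _ _)) ?subrr ?normr0// ler_wpM2l// ltW.
have gB : `|g z| <= B.
  rewrite -[g z](subrK (g x)) addrC (le_trans (ler_normD _ _))// lerD2l.
  by rewrite (le_trans (gk _ _ _ _)) ?subrr ?normr0// ler_wpM2l// ltW.
have -> : f y * g y - f z * g z = f y * (g y - g z) + g z * (f y - f z) by ring.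
rewrite (le_trans (ler_normD _ _))// !normrM mulrDl -!mulrA.
by apply: lerD; apply: ler_pM => //; [exact: gk|exact: fk].
Qed.

Lemma locally_lipschitz_sum V W (I : finType) (f : I -> V -> W) :
  (forall i, locally_lipschitz (f i)) ->
  locally_lipschitz (fun x => \sum_i f i x).
Proof.
move=> fl; rewrite (_ : (fun _ => _) = \sum_i f i); last first.
  by apply/funext => x; rewrite fct_sumE.
elim/big_ind : _ => [|g h gl hl|i _]; last exact: fl.
  exact: locally_lipschitz_cst.
exact: locally_lipschitzD.
Qed.

(** Expanding in the matrices [delta_mx i j] reduces the claim to sums of fixed linear maps applied
    to the entries. *)
Lemma locally_lipschitz_mx V m n (f : V -> 'M[R]_(m, n)) :
  (forall i j, locally_lipschitz (fun x => f x i j)) -> locally_lipschitz f.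
Proof.
move=> fl; rewrite (_ : f = (fun x => \sum_i \sum_j f x i j *: delta_mx i j)).
  apply: locally_lipschitz_sum => i; apply: locally_lipschitz_sum => j.
  pose s := fun c : R => c *: (delta_mx i j : 'M[R]_(m, n)).
  apply: (@locally_lipschitz_comp _ _ _ s) => //.
  apply/locally_lipschitzP => x.
  exists 1, `|delta_mx i j : 'M[R]_(m, n)|; split=> // y z _ _.
  by rewrite -scalerBl normrZ mulrC.
by apply/funext => x; exact: matrix_sum_delta.
Qed.

Lemma locally_lipschitz_coord m n i j :
  locally_lipschitz (fun x : 'M[R]_(m, n) => x i j).
Proof.
apply/locally_lipschitzP => x; exists 1, 1; split=> // y z _ _.
by rewrite mul1r; have := mx_coord_le (y - z) i j; rewrite !mxE.
Qed.

Lemma locally_lipschitz_usubmx m1 m2 n :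
  locally_lipschitz (@usubmx R m1 m2 n).
Proof.
apply: locally_lipschitz_mx => i j; 
  rewrite (_ : (fun _ => _) = fun x : 'M[R]_(m1 + m2, n) => x (lshift m2 i) j).
  exact: locally_lipschitz_coord.
by apply/funext => x; rewrite mxE.
Qed.

Lemma locally_lipschitz_dsubmx m1 m2 n :
  locally_lipschitz (@dsubmx R m1 m2 n).
Proof.
apply: locally_lipschitz_mx => i j; 
  rewrite (_ : (fun _ => _) = fun x : 'M[R]_(m1 + m2, n) => x (rshift m1 i) j).
  exact: locally_lipschitz_coord.
by apply/funext => x; rewrite mxE.
Qed.

Lemma rcmul_sum n (u : 'rV[R]_n) (v : 'cV[R]_n) :
  rcmul u v = \sum_i u 0 i * v i 0.
Proof. by rewrite /rcmul mxE. Qed.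

Lemma normr_rcmul n (u : 'rV[R]_n) (v : 'cV[R]_n) :
  `|rcmul u v| <= n%:R * (`|u| * `|v|).
Proof.
rewrite rcmul_sum (le_trans (ler_norm_sum _ _ _))//.
apply: (@le_trans _ _ (\sum_(i < n) `|u| * `|v|)).
  by apply: ler_sum => i _; rewrite normrM ler_pM// mx_coord_le.
by rewrite sumr_const card_ord mulr_natl.
Qed.

Lemma locally_lipschitz_rcmul V n (f : V -> 'rV[R]_n) (g : V -> 'cV[R]_n) :
  locally_lipschitz f -> locally_lipschitz g ->
  locally_lipschitz (fun x => rcmul (f x) (g x)).
Proof.
move=> fl gl; rewrite (_ : (fun _ => _) = fun x => \sum_i f x 0 i * g x i 0).
  apply: locally_lipschitz_sum => i; apply: locally_lipschitzM.
    apply: (locally_lipschitz_comp (g := fun v : 'rV[R]_n => v 0 i)) fl.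
    exact: locally_lipschitz_coord.
  apply: (locally_lipschitz_comp (g := fun v : 'cV[R]_n => v i 0)) gl.
  exact: locally_lipschitz_coord.
by apply/funext => x; exact: rcmul_sum.
Qed.

Lemma diff_gradient n (P : 'cV[R]_n -> R) y v : differentiable P y ->
  'd P y v = rcmul (gradient P y) v.
Proof.
move=> dP; rewrite [in LHS](matrix_sum_delta v) linear_sum rcmul_sum.
apply: eq_bigr => i _; rewrite big_ord1 linearZ /= mxE mulrC.
by rewrite /partial_derivative deriveE.
Qed.

(** The mean value theorem is applied on the segment from [z] to [y], which stays in a ball where
    the gradient is within [1] of its value at the centre. The factor [n] is the price of pairing
    two vectors measured in the sup norm. *)
Lemma C1_locally_lipschitz n (P : 'cV[R]_n -> R) : C1 P -> locally_lipschitz P.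
Proof.
move=> [dP cP]; apply/locally_lipschitzP => x.
have /cvgrPdist_lt /(_ 1 ltr01) := cP x.
move=> /nbhs_ballP[d /= d0 Pd].
pose M := `|gradient P x| + 1.
have M0 : 0 <= M by rewrite addr_ge0.
exists d, (n%:R * M); split=> //; first by rewrite mulr_ge0.
move=> y z yd zd.
pose l (t : R) : 'cV[R]_n := z + t *: (y - z).
have dl (t : R) : is_derive t (1 : R) (P \o l : R -> R) ('d P (l t) (y - z)).
  have dl : is_diff t l (fun h => h *: (y - z)).
    have -> : l = cst z + ( *:%R ^~ (y - z)) by [].
    by apply: is_diff_eq; apply/funext => h; rewrite /= fctE add0r.
  have dPl : is_diff t (P \o l) ('d P (l t) \o (fun h => h *: (y - z))).
    by apply: is_diff_comp; exact: differentiableP.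
  split; first by apply/derivable1_diffP; exact: ex_diff.
  by rewrite deriveE ?diff_val /= ?scale1r//; exact: ex_diff.
have [|t t01] := @MVT R (P \o l) (fun t => 'd P (l t) (y - z)) 0 1 ltr01 (fun t _ => dl t).
  by apply: derivable_within_continuous => t _; have [] := dl t.
have l1 : l 1 = y by rewrite /l scale1r addrC subrK.
have l0 : l 0 = z by rewrite /l scale0r addr0.
rewrite subr0 mulr1 /= l1 l0 => ->.
rewrite diff_gradient// (le_trans (normr_rcmul _ _))// -mulrA ler_wpM2l// ler_wpM2r//.
suff /Pd /ltW : ball x d (l t).
  by move=> gl; rewrite -lerBlDl (le_trans (lerB_dist _ _))// distrC.
rewrite -ball_normE /=.
move: t01; rewrite in_itv /= => /andP[t0 t1].
(* Convexity of the ball. *)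
have -> : x - l t = (1 - t) *: (x - z) + t *: (x - y).
  by apply/matrixP => i j; rewrite !mxE; ring.
rewrite (le_lt_trans (ler_normD _ _))// !normrZ !gtr0_norm ?subr_gt0//.
rewrite -[d in ltRHS](_ : (1 - t) * d + t * d = d); last by ring.
by apply: ltrD; rewrite ltr_pM2l ?subr_gt0// distrC.
Qed.

End LocallyLipschitz.

(** * Lyapunov functions along solutions, and global existence *)

Section Lyapunov.
Context {R : realType} {N : nat}.
Implicit Types (F : 'cV[R]_N -> 'cV[R]_N) (W : 'cV[R]_N -> R).

(** The chain rule and the mean value theorem for [W] along [x] replace the integration of the
    differential inequality. *)
Lemma solution_diff_le F (T : \bar R) x0 x W (a b c : R) :
  is_solution F T x0 x -> (forall y, differentiable W y) ->
  0 <= a <= b -> (b%:E < T)%E ->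
  (forall t, a < t < b -> 'd W (x t) (F (x t)) <= c) ->
  W (x b) <= W (x a) + c * (b - a).
Proof.
move=> xs dW /andP[a0 ab] bT Wc.
move: ab; rewrite le_eqVlt => /predU1P[<-|ab]; first by rewrite subrr mulr0 addr0.
have Wx t : t \in `]a, b[%R ->
    is_derive t (1 : R) (W \o x : R -> R) ('d W (x t) (F (x t))).
  move=> /(solution_derive xs a0 bT) [dx Fx].
  have dx' : differentiable x t by exact/derivable1_diffP.
  have dWx : differentiable (W \o x) t by apply: differentiable_comp.
  split; first exact/derivable1_diffP.
  by rewrite deriveE// diff_comp//= -Fx deriveE.
have Wc' : {within `[a, b], continuous (W \o x)}.
  have /subspace_continuousP xc := solution_within xs a0 bT.
  apply/subspace_continuousP => t tab.
  have Wt : {for x t, continuous W} by exact: differentiable_continuous.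
  exact: continuous_cvg Wt (xc t tab).
have [t + /=] := MVT ab Wx Wc'; rewrite in_itv /= => tab eW.
by rewrite -lerBlDl eW ler_wpM2r ?subr_ge0 ?(ltW ab)// Wc.
Qed.

Lemma continuous_dist_lt (U V : normedModType R) (f : U -> V) (x : U) (e : R) :
  continuous f -> 0 < e ->
  exists2 d, 0 < d & forall y, `|x - y| < d -> `|f x - f y| < e.
Proof.
move=> fc e0; have /cvgrPdist_lt /(_ e e0) := fc x.
move=> /nbhs_ballP[d /= d0 fd]; exists d => // y xy; apply: fd.
by rewrite -ball_normE.
Qed.

Lemma continuous_bounded_ball n (V : normedModType R) (f : 'cV[R]_n -> V) (r : R) :
  continuous f -> exists2 M, 0 <= M & forall x, `|x| <= r -> `|f x| <= M.
Proof.
move=> fc; have : bounded_set (f @` [set x | `|x| <= r]).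
  apply: compact_bounded; apply: continuous_compact.
    exact: continuous_subspaceT.
  exact: compact_closed_ball_cV.
move=> /ex_strict_bound_gt0[M M0 fM].
exists M; first exact: ltW.
by move=> x xr; apply/ltW/fM; exists x.
Qed.

(* The field is multiplied by a cutoff; the cutoff being nonnegative, [W] still
   decreases, which keeps the solution where the cutoff is [1]. *)
Theorem global_solution F W (x0 : 'cV[R]_N) :
  continuous F -> (forall y, differentiable W y) ->
  (forall y, 'd W y (F y) <= 0) ->
  (exists r : R, forall y, W y <= W x0 -> `|y| <= r) ->
  exists x : R -> 'cV[R]_N, is_solution F +oo%E x0 x.
Proof.
move=> Fc dW WF [r Wr].
(* Continuous cutoff with values in [[0, 1]], equal to [1] on the ball of radius [r] and to [0]
   outside that of radius [r + 1]. *)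
pose chi (y : 'cV[R]_N) : R := Num.max 0 (Num.min 1 (r + 1 - `|y|)).
have chi0 y : 0 <= chi y by rewrite le_max lexx.
have chi1 y : chi y <= 1 by rewrite ge_max ler01 ge_min lexx.
have chic : continuous chi.
  have c1 : continuous (fun y : 'cV[R]_N => r + 1 - `|y|).
    move=> y; have c2 : {for y, continuous (fun _ : 'cV[R]_N => r + 1)} by apply: cst_continuous.
    exact: (continuousB c2 (@norm_continuous _ _ y)).
  move=> y; have c0 (c : R) : {for y, continuous (fun _ : 'cV[R]_N => c)} by apply: cst_continuous.
  exact: (@continuous_max R 'cV[R]_N _ _ y (c0 0)
           (@continuous_min R 'cV[R]_N _ _ y (c0 1) (c1 y))).
have [M M0 FM] := continuous_bounded_ball (r + 1) Fc.
have Gc : continuous (fun y => chi y *: F y).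
  by move=> y; exact: cvgZ (chic y) (Fc y).
have GM y : `|chi y *: F y| <= M.
  rewrite normrZ ger0_norm//; have [yr|yr] := leP `|y| (r + 1).
    by rewrite -[M]mul1r ler_pM// FM.
  rewrite (_ : chi y = 0) ?mul0r//; apply/max_idPl.
  by rewrite ge_min; apply/orP; right; rewrite subr_le0 ltW.
have [x xs] := bounded_field_solution x0 Gc GM.
have x00 : x 0 = x0 by case: xs.
exists x; have [? ? xd] := xs; split => // t t0 tT.
have := xd t t0 tT; rewrite (_ : chi (x t) = 1) ?scale1r//.
have := @solution_diff_le _ _ _ _ W 0 t 0 xs dW.
rewrite lexx (ltW t0) mul0r addr0 x00 => /(_ isT tT) Wx.
have xr : `|x t| <= r.
  apply/Wr/Wx => s _; rewrite linearZ /=.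
  by rewrite mulr_ge0_le0.
by rewrite /chi min_l ?max_r ?ler01//; move: xr; clear; lra.
Qed.

End Lyapunov.

(** * Euclidean norm against sup norm, and derivatives of functions of the two blocks *)

Section Euclidean.
Context {R : realType}.

Lemma enorm_sqr n (v : 'cV[R]_n) : enorm v ^+ 2 = \sum_i v i 0 ^+ 2.
Proof. by rewrite sqr_sqrtr// sumr_ge0// => i _; rewrite sqr_ge0. Qed.

Lemma enorm_ge0 n (v : 'cV[R]_n) : 0 <= enorm v.
Proof. exact: sqrtr_ge0. Qed.

Lemma norm_le_enorm n (v : 'cV[R]_n) : `|v| <= enorm v.
Proof.
apply: mx_norm_le => [|i j]; first exact: enorm_ge0.
rewrite ord1 -sqrtr_sqr ler_sqrt ?sumr_ge0// => [|k _]; last exact: sqr_ge0.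
by rewrite (bigD1 i)//= lerDl sumr_ge0// => k _; rewrite sqr_ge0.
Qed.

(** The crude factor [n.+1] is positive in every dimension, so that it can be divided by later. *)
Lemma enorm_le_norm n (v : 'cV[R]_n) : enorm v <= n.+1%:R * `|v|.
Proof.
rewrite -(ler_pXn2r (n := 2))// ?nnegrE ?enorm_ge0 ?mulr_ge0//.
rewrite enorm_sqr exprMn.
apply: (@le_trans _ _ (\sum_(i < n) `|v| ^+ 2)).
  apply: ler_sum => i _; rewrite -real_normK ?num_real// ler_pXn2r ?nnegrE//.
  exact: mx_coord_le.
rewrite sumr_const card_ord -[leLHS]mulr_natl ler_wpM2r ?sqr_ge0//.
by rewrite -natrX ler_nat (leq_trans (leqnSn n))// leq_pmulr.
Qed.

Lemma norm_usubmx_le m1 m2 n (A : 'M[R]_(m1 + m2, n)) : `|usubmx A| <= `|A|.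
Proof. by apply: mx_norm_le => // i j; rewrite mxE mx_coord_le. Qed.

Lemma norm_vsubmx_le m1 m2 n (A : 'M[R]_(m1 + m2, n)) (c : R) :
  `|usubmx A| <= c -> `|dsubmx A| <= c -> `|A| <= c.
Proof.
move=> uc dc; apply: mx_norm_le => [|i j]; first exact: le_trans uc.
rewrite -[A]vsubmxK mxE; case: splitP => k _.
  by rewrite (le_trans (mx_coord_le _ _ _)).
by rewrite (le_trans (mx_coord_le _ _ _)).
Qed.

Lemma rcmulD n (u : 'rV[R]_n) (v w : 'cV[R]_n) :
  rcmul u (v + w) = rcmul u v + rcmul u w.
Proof. by rewrite /rcmul mulmxDr mxE. Qed.

Lemma rcmulZ n (u : 'rV[R]_n) (a : R) (v : 'cV[R]_n) :
  rcmul u (a *: v) = a * rcmul u v.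
Proof. by rewrite /rcmul -scalemxAr mxE. Qed.

Lemma is_diff_sum (V : normedModType R) n (h dh : 'I_n -> V -> R) (x : V) :
  (forall i, is_diff x (h i) (dh i)) ->
  is_diff x (\sum_i h i) (\sum_i dh i).
Proof.
by move=> hd; elim/big_ind2 : _ => [|? ? ? ? ? ?|i _] //;
  [exact: is_diff_cst|exact: is_diffD].
Qed.

Lemma is_diff_usubmx n p (P : 'cV[R]_n -> R) (x : 'cV[R]_(n + p)) :
  differentiable P (usubmx x) ->
  is_diff x (fun x => P (usubmx x))
    (fun v => rcmul (gradient P (usubmx x)) (usubmx v)).
Proof.
move=> dP; have uc : continuous (@usubmx R n p 1).
  exact/locally_lipschitz_continuous/locally_lipschitz_usubmx.
have ud : is_diff x (@usubmx R n p 1) (@usubmx R n p 1).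
  by apply: DiffDef; [exact: linear_differentiable|rewrite diff_lin].
have -> : (fun v => rcmul (gradient P (usubmx x)) (usubmx v)) =
    'd P (usubmx x) \o @usubmx R n p 1.
  by apply/funext => v; rewrite /= diff_gradient.
by apply: (@is_diff_comp _ _ _ _ _ _ P) => //; exact: differentiableP.
Qed.

(** The squared norm is a sum of squares of the coordinate forms [c i], and each of these is linear
    and continuous. *)
Lemma is_diff_enorm_dsubmx n p (x : 'cV[R]_(n + p)) :
  is_diff x (fun x => enorm (dsubmx x) ^+ 2)
    (fun v => 2 * rcmul (dsubmx x)^T (dsubmx v)).
Proof.
pose c i (y : 'cV[R]_(n + p)) : R := y (rshift n i) 0.
have cl i : linear (c i) by move=> a u v; rewrite /c !mxE.
have -> : (fun x => enorm (dsubmx x) ^+ 2) = \sum_(i < p) (c i ^+ 2).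
  apply/funext => y; rewrite enorm_sqr fct_sumE; apply: eq_bigr => i _.
  by rewrite mxE fctE.
have -> : (fun v => 2 * rcmul (dsubmx x)^T (dsubmx v)) =
    \sum_(i < p) ((2%:R * c i x ^+ 1) *: c i).
  apply/funext => v; rewrite fct_sumE rcmul_sum mulr_sumr; apply: eq_bigr => i _.
  by rewrite !mxE mulrA.
apply: is_diff_sum => i; apply: is_diffX.
pose lc := GRing.isLinear.Build _ _ _ _ _ (cl i).
pose cL : {linear _ -> _} := HB.pack (c i) lc.
have cc : continuous (c i) by exact: coord_continuous.
apply: DiffDef; first exact: (@linear_differentiable _ _ _ cL).
by rewrite (diff_lin (f := cL)).
Qed.

End Euclidean.

(** * Sublevel sets of a radially unbounded function *)

Section RadiallyUnbounded.
Context {R : realType} {n : nat} (P : 'cV[R]_n -> R).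
Hypothesis Prad : radially_unbounded P.

Lemma sublevel_bounded (c : R) : exists2 r : R, 0 <= r & forall y, P y <= c -> `|y| <= r.
Proof.
(* Radial unboundedness speaks of positive levels, and [c] may be negative. *)
have c1 : 0 < `|c| + 1 by rewrite ltr_wpDl.
have [M [_ Mb]] := compact_bounded (Prad c1).
exists (`|M| + 1) => [|y Pc]; first by rewrite addr_ge0.
apply: (Mb (`|M| + 1)); first by rewrite (le_lt_trans (ler_norm _))// ltrDl.
by rewrite /= (le_trans Pc)// (le_trans (ler_norm c))// lerDl.
Qed.

(** [W] attains its minimum on the compact part of the sublevel set outside the ball of radius [e],
    and is positive there. It is used with [W = P] to control the output, and with [W = Q] to get a
    decay rate. *)
Lemma positive_definite_lower_bound (W : 'cV[R]_n -> R) (c e : R) :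
  continuous W -> positive_definite W -> 0 < c -> 0 < e ->
  exists2 q : R, 0 < q & forall y, P y <= c -> e <= `|y| -> q <= W y.
Proof.
move=> Wc [_ Wpos] c0 e0.
pose K := [set y | P y <= c] `&` [set y : 'cV[R]_n | e <= `|y|].
have Kc : compact K.
  apply: compact_closedI; first exact: Prad.
  apply: (@closed_comp _ _ (@Num.norm R 'cV[R]_n) [set r | e <= r]) => [y _|].
    exact: norm_continuous.
  exact: closed_ge.
(* If [K] is empty the bound is vacuous, and [1] is an arbitrary choice. *)
have [K0|/set0P K0] := eqVneq K set0.
  exists 1 => // y yc ye; have : K y by [].
  by rewrite K0.
have [y yK Wy] := compact_EVT_min K0 Kc (continuous_subspaceT Wc).
exists (W y) => [|z zc ze]; last by apply: Wy; rewrite inE.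
apply: Wpos; rewrite -normr_gt0 (lt_le_trans e0)//.
by move: yK; rewrite inE => -[].
Qed.

End RadiallyUnbounded.

(** * The closed loop: regularity of the field and dissipation inequalities *)

Section ClosedLoop.
Context {R : realType} {n p : nat}.
Variables (f g : 'cV[R]_n -> 'cV[R]_n) (varphi : 'cV[R]_n -> 'cV[R]_p).
Variables (P Q k mu : 'cV[R]_n -> R) (gamma L : R).
Hypotheses (fl : locally_lipschitz f) (gl : locally_lipschitz g).
Hypotheses (varphil : locally_lipschitz varphi) (kl : locally_lipschitz k).
Hypotheses (mul : locally_lipschitz mu) (mupos : forall y, 0 < mu y).
Hypotheses (PC2 : C2 P) (Ppos : positive_definite P) (Prad : radially_unbounded P).
Hypotheses (QC1 : C1 Q) (Qpos : positive_definite Q).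
Hypothesis PQ : forall y, rcmul (gradient P y) (f y)
                  + rcmul (gradient P y) (g y) * k y <= - Q y.
Hypothesis muQ : forall y, enorm (varphi y) ^+ 2 <= mu y * Q y.
Hypotheses (gamma0 : 0 < gamma) (L0 : 0 < L).

Let F : 'cV[R]_(n + p) -> 'cV[R]_(n + p) := closed_loop f g varphi P k mu gamma L.
Let Py (x : 'cV[R]_(n + p)) : R := P (usubmx x).
Let V (x : 'cV[R]_(n + p)) : R := P (usubmx x) + gamma / 2 * enorm (dsubmx x) ^+ 2.
Let w (y : 'cV[R]_n) : R := rcmul (gradient P y) (g y).

Let dP y : differentiable P y. Proof. by case: PC2 => -[]. Qed.

Let Pc : continuous P.
Proof. by move=> y; exact: differentiable_continuous. Qed.

Let P_ge0 y : 0 <= P y.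
Proof.
by case: Ppos => P0 Pgt0; have [->|/Pgt0/ltW//] := eqVneq y 0; rewrite P0.
Qed.

Let Q_ge0 y : 0 <= Q y.
Proof.
by case: Qpos => Q0 Qgt0; have [->|/Qgt0/ltW//] := eqVneq y 0; rewrite Q0.
Qed.

(** Second-order smoothness of [P] enters here: it makes the feedback, hence the whole field,
    locally Lipschitz. *)
Lemma gradient_locally_lipschitz : locally_lipschitz (gradient P).
Proof.
case: PC2 => _ dPC1; apply: locally_lipschitz_mx => i j.
rewrite (_ : (fun _ => _) = partial_derivative j P).
  exact: C1_locally_lipschitz.
by apply/funext => y; rewrite mxE.
Qed.

Lemma closed_loop_locally_lipschitz : locally_lipschitz F.
Proof.
have ul := @locally_lipschitz_usubmx R n p 1.
have dl := @locally_lipschitz_dsubmx R n p 1.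
have coord m i (h : 'cV[R]_(n + p) -> 'cV[R]_m) : locally_lipschitz h ->
    locally_lipschitz (fun x => h x i 0).
  move=> hl; apply: (locally_lipschitz_comp (g := fun v : 'cV[R]_m => v i 0)) hl.
  exact: locally_lipschitz_coord.
have wl : locally_lipschitz (fun x : 'cV[R]_(n + p) => w (usubmx x)).
  apply: (locally_lipschitz_comp (g := w)) ul.
  exact: locally_lipschitz_rcmul gradient_locally_lipschitz gl.
have fl' := locally_lipschitz_comp fl ul.
have gl' := locally_lipschitz_comp gl ul.
have kl' := locally_lipschitz_comp kl ul.
have mul' := locally_lipschitz_comp mul ul.
have varphil' := locally_lipschitz_comp varphil ul.
have vz : locally_lipschitz
    (fun x : 'cV[R]_(n + p) => rcmul (varphi (usubmx x))^T (dsubmx x)).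
  apply: locally_lipschitz_rcmul dl; apply: locally_lipschitz_mx => i j.
  rewrite (_ : (fun _ => _) = fun x : 'cV[R]_(n + p) => varphi (usubmx x) j 0).
    exact: coord.
  by apply/funext => x; rewrite mxE ord1.
apply: locally_lipschitz_mx => i j; rewrite ord1.
case: (splitP i) => a ia.
  rewrite (_ : (fun _ => _) = fun x : 'cV[R]_(n + p) => f (usubmx x) a 0 +
     (k (usubmx x) + - (L * mu (usubmx x) * w (usubmx x))
        + - rcmul (varphi (usubmx x))^T (dsubmx x)) * g (usubmx x) a 0).
    apply: locally_lipschitzD; first exact: coord.
    apply: locally_lipschitzM; last exact: coord.
    apply: locally_lipschitzD; last exact: locally_lipschitzN.
    apply: locally_lipschitzD => //; apply: locally_lipschitzN.
    apply: locally_lipschitzM => //; apply: locally_lipschitzM => //.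
    exact: locally_lipschitz_cst.
  apply/funext => x; rewrite (_ : i = lshift p a); last exact/val_inj.
  by rewrite /F /closed_loop col_mxEu !mxE.
rewrite (_ : (fun _ => _) = fun x : 'cV[R]_(n + p) =>
    gamma^-1 * w (usubmx x) * varphi (usubmx x) a 0).
  apply: locally_lipschitzM; last exact: coord.
  by apply: locally_lipschitzM => //; exact: locally_lipschitz_cst.
apply/funext => x; rewrite (_ : i = rshift n a); last exact/val_inj.
by rewrite /F /closed_loop col_mxEd !mxE.
Qed.

Let diffPy x : is_diff x Py
  (fun v => rcmul (gradient P (usubmx x)) (usubmx v)).
Proof. exact: is_diff_usubmx. Qed.

Let diffV x : is_diff x V
  (fun v => rcmul (gradient P (usubmx x)) (usubmx v)
            + gamma * rcmul (dsubmx x)^T (dsubmx v)).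
Proof.
have h1 := diffPy x; have h2 := is_diff_enorm_dsubmx x.
have -> : V = Py + gamma / 2 \*: (fun x => enorm (dsubmx x) ^+ 2) by [].
apply: is_diff_eq; apply/funext => v /=; rewrite !fctE.
congr (_ + _); rewrite [LHS]mulrA; congr (_ * _).
by rewrite divfK.
Qed.

Let dPy x : differentiable Py x. Proof. by have := diffPy x. Qed.
Let dV x : differentiable V x. Proof. by have := diffV x. Qed.

(** Hypothesis (H) absorbs the terms in [f] and [k]; the damping and the parameter error remain. *)
Lemma Py_dot_le x : 'd Py x (F x) <=
  - Q (usubmx x) - L * mu (usubmx x) * w (usubmx x) ^+ 2
  - w (usubmx x) * rcmul (varphi (usubmx x))^T (dsubmx x).
Proof.
have h := diffPy x; rewrite diff_val /F /closed_loop col_mxKu rcmulD rcmulZ.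
have := PQ (usubmx x); rewrite -/(w _); nra.
Qed.

(** The adaptation law is designed for this: the derivative of [gamma |z|^2 / 2] is [w] times the
    product of [varphi] and [z], which cancels the parameter error term of [Py_dot_le]. The damping
    term has the right sign and is dropped. *)
Lemma V_dot_le x : 'd V x (F x) <= - Q (usubmx x).
Proof.
have h1 := diffPy x; have h := diffV x; rewrite diff_val.
have := Py_dot_le x; rewrite diff_val.
have -> : dsubmx (F x) = (gamma^-1 * w (usubmx x)) *: varphi (usubmx x).
  by rewrite /F /closed_loop col_mxKd.
rewrite rcmulZ !mulrA divff ?gt_eqF// mul1r.
have -> : rcmul (dsubmx x)^T (varphi (usubmx x)) =
          rcmul (varphi (usubmx x))^T (dsubmx x).
  by rewrite !rcmul_sum; apply: eq_bigr => i _; rewrite !mxE mulrC.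
rewrite -/(w _) => Pd.
have : 0 <= L * mu (usubmx x) * w (usubmx x) ^+ 2.
  exact: mulr_ge0 (mulr_ge0 (ltW L0) (ltW (mupos _))) (sqr_ge0 _).
lra.
Qed.

(* Young's inequality with weight [mu]; this is where the level [gamma * L]
   in the definition of [Omega] comes from. *)
Lemma Py_dot_le_half x : V x <= gamma * L -> 'd Py x (F x) <= - (Q (usubmx x) / 2).
Proof.
move=> Vx; apply: le_trans (Py_dot_le x) _.
set y := usubmx x; set z := dsubmx x; have m0 := mupos y.
have zL : enorm z ^+ 2 <= 2 * L.
  rewrite -(ler_pM2l (x := gamma / 2)) ?divr_gt0//.
  by have := P_ge0 y; move: Vx; rewrite /V -/y -/z; lra.
suff : - (w y * rcmul (varphi y)^T z) <= Q y / 2 + L * mu y * w y ^+ 2 by lra.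
apply: (@le_trans _ _ (\sum_i ((2 * mu y)^-1 * varphi y i 0 ^+ 2 +
                               mu y / 2 * w y ^+ 2 * z i 0 ^+ 2))).
  rewrite rcmul_sum mulr_sumr -sumrN; apply: ler_sum => i _; rewrite mxE.
  rewrite -subr_ge0.
  (* Entrywise, the gap in Young's inequality is a nonnegative multiple of a square. *)
  have -> : (2 * mu y)^-1 * varphi y i 0 ^+ 2 + mu y / 2 * w y ^+ 2 * z i 0 ^+ 2
      - - (w y * (varphi y i 0 * z i 0))
      = (2 * mu y)^-1 * (varphi y i 0 + mu y * w y * z i 0) ^+ 2.
    by field; rewrite gt_eqF.
  by rewrite mulr_ge0 ?sqr_ge0// invr_ge0 mulr_ge0// ltW.
(* Condition (A) bounds the first sum by [Q y / 2]; the bound [2 * L] on the squared norm of [z]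
   turns the second into the damping. *)
rewrite big_split /= -!mulr_sumr -!enorm_sqr lerD//.
  by rewrite ler_pdivrMl ?mulr_gt0//; have := muQ y; lra.
have : mu y / 2 * w y ^+ 2 * enorm z ^+ 2 <= mu y / 2 * w y ^+ 2 * (2 * L).
  by rewrite ler_wpM2l// mulr_ge0 ?sqr_ge0// divr_ge0// ltW.
lra.
Qed.


Let V_ge_P x : P (usubmx x) <= V x.
Proof. by rewrite lerDl mulr_ge0 ?sqr_ge0// divr_ge0// ltW. Qed.

Lemma V_sublevel_bounded (c : R) : exists2 r : R, 0 <= r & forall x, V x <= c -> `|x| <= r.
Proof.
have [r r0 Pr] := sublevel_bounded Prad c.
(* With [a = 2 |c| / gamma], one has [|z|^2 <= a <= (1 + a)^2], which avoids a square root. *)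
exists (r + (1 + 2 * `|c| / gamma)) => [|x Vc].
  by rewrite addr_ge0// addr_ge0// divr_ge0 ?mulr_ge0// ltW.
have c0 : 0 <= 2 * `|c| / gamma by rewrite divr_ge0 ?mulr_ge0// ltW.
apply: norm_vsubmx_le.
  by rewrite (le_trans (Pr _ (le_trans (V_ge_P x) Vc)))// lerDl addr_ge0.
apply: le_trans (norm_le_enorm _) _.
have zc : enorm (dsubmx x) ^+ 2 <= 2 * `|c| / gamma.
  rewrite ler_pdivlMr//; have := P_ge0 (usubmx x); have := ler_norm c.
  by move: Vc; rewrite /V; lra.
apply: (@le_trans _ _ (1 + 2 * `|c| / gamma)); last by rewrite lerDr.
rewrite -(ler_pXn2r (n := 2))// ?nnegrE ?enorm_ge0 ?addr_ge0//.
by rewrite (le_trans zc)//; nra.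
Qed.

Lemma flow_exists : exists phi : R -> 'cV[R]_(n + p) -> 'cV[R]_(n + p),
  forall x0, is_solution F +oo%E x0 (phi ^~ x0).
Proof.
have /choice[sol solP] x0 : exists x : R -> 'cV[R]_(n + p), is_solution F +oo%E x0 x.
  apply: (global_solution (W := V)).
  - exact/locally_lipschitz_continuous/closed_loop_locally_lipschitz.
  - exact: dV.
  - by move=> y; rewrite (le_trans (V_dot_le y))// oppr_le0.
  by have [r _ rP] := V_sublevel_bounded (V x0); exists r.
by exists (fun t x0 => sol x0 t).
Qed.

(** * Stability and convergence of the output along the flow *)

Section Flow.
Variable phi : R -> 'cV[R]_(n + p) -> 'cV[R]_(n + p).
Hypothesis phiP : forall x0, is_solution F +oo%E x0 (phi ^~ x0).

Let phi0 x0 : phi 0 x0 = x0. Proof. by have [] := phiP x0. Qed.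

(** A solution on [[0, T)] is compared with the restriction of the global one to the same
    interval. *)
Lemma flow_is_flow_on Omega : is_flow_on F Omega phi.
Proof.
move=> x0 _; split=> // T x xs t t0 tT.
have phiT : is_solution F T x0 (phi ^~ x0).
  have [? xc xd] := phiP x0; split => // [|r r0 _]; last by apply: xd; rewrite ?ltry.
  by apply: continuous_subspaceW xc => r [r0 _]; split; rewrite ?ltry.
exact: solution_unique closed_loop_locally_lipschitz xs phiT t t0 tT.
Qed.

Lemma V_decrease x0 (a b c : R) : 0 <= a <= b ->
  (forall t, a < t < b -> c <= Q (usubmx (phi t x0))) ->
  V (phi b x0) <= V (phi a x0) - c * (b - a).
Proof.
move=> ab cQ; rewrite -mulNr.
apply: (solution_diff_le (phiP x0)) => // [|t tab]; first exact: ltry.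
by rewrite (le_trans (V_dot_le _))// lerN2 cQ.
Qed.

Lemma V_nonincreasing x0 (a b : R) : 0 <= a <= b -> V (phi b x0) <= V (phi a x0).
Proof.
by move=> ab; have := @V_decrease x0 a b 0 ab; rewrite mul0r subr0; apply.
Qed.

Lemma V_le_initial x0 t : 0 <= t -> V (phi t x0) <= V x0.
Proof. by move=> t0; rewrite -[x0 in leRHS]phi0 V_nonincreasing ?lexx. Qed.

Let Vc : continuous V.
Proof. by move=> x; exact: differentiable_continuous. Qed.

Lemma flow_lagrange Omega : lagrange_output_stable phi (@usubmx R n p 1) Omega.
Proof.
(* [M] bounds [V] over the initial states, and [b] bounds the sublevel set of [P] at height [M]. *)
move=> r r0; have [M M0 VM] := continuous_bounded_ball r Vc.
have [b b0 Pb] := sublevel_bounded Prad M.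
exists (n.+1%:R * b); split; first exact: num_real.
move=> c bc _ [x0 [x0r _] [t t0 <-]].
rewrite /= ger0_norm ?enorm_ge0// (le_trans (enorm_le_norm _))//.
rewrite (le_trans _ (ltW bc))// ler_wpM2l//; apply: Pb.
rewrite (le_trans (V_ge_P _))// (le_trans (V_le_initial _ t0))//.
rewrite (le_trans (ler_norm _))// VM// (le_trans (norm_le_enorm _))//.
exact: ltW.
Qed.

(** Small values of [P] force a small output. The level [1] only selects a compact sublevel set, on
    which [P] is bounded below away from the origin. *)
Let P_small (e : R) : 0 < e ->
  exists2 q : R, 0 < q & forall y, P y < q -> enorm y <= e.
Proof.
move=> e0; have n0 : (0 : R) < n.+1%:R by rewrite ltr0n.
have en : 0 < e / n.+1%:R by rewrite divr_gt0.
have [q q0 qP] := positive_definite_lower_bound Prad Pc Ppos ltr01 en.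
exists (Num.min 1 q) => [|y]; first by rewrite lt_min ltr01.
rewrite lt_min => /andP[P1 Pq]; rewrite (le_trans (enorm_le_norm _))//.
rewrite mulrC -ler_pdivlMr//; have [//|/ltW ye] := leP `|y| (e / n.+1%:R).
by have := qP y (ltW P1) ye; rewrite leNgt Pq.
Qed.

Lemma flow_lyapunov Omega : lyapunov_output_stable phi (@usubmx R n p 1) Omega.
Proof.
move=> e e0; have [q q0 qP] := P_small e0.
have V0 : V 0 = 0.
  rewrite /V !linear0; case: Ppos => -> _.
  by rewrite enorm_sqr big1 ?mulr0 ?addr0// => i _; rewrite mxE expr0n.
have [d d0 Vd] := continuous_dist_lt 0 Vc q0; exists d => // x0 [x0d _] t t0.
apply: qP; rewrite (le_lt_trans (V_ge_P _))// (le_lt_trans (V_le_initial _ t0))//.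
have /Vd : `|0 - x0| < d by rewrite sub0r normrN (le_lt_trans (norm_le_enorm _)).
rewrite V0 sub0r normrN; exact/le_lt_trans/ler_norm.
Qed.

(* [V] loses a fixed amount whenever the output is larger than [e], since the
   output is Lipschitz in time and so stays larger than [e / 2] for a while. *)
Lemma flow_attractive Omega : output_attractive phi (@usubmx R n p 1) Omega.
Proof.
move=> x0 _; apply/cvgrPdist_le => e e0.
suff [T Te] : exists T : R, forall t, T <= t -> `|usubmx (phi t x0)| <= e.
  near=> t; rewrite sub0r normrN; apply: Te; near: t.
  by apply: nbhs_pinfty_ge; exact: num_real.
(* Otherwise the output exceeds [e] at arbitrarily late times. *)
apply: contrapT => /forallNP H.
have {}H T : exists2 t, T <= t & e < `|usubmx (phi t x0)|.
  have /existsNP[t /not_implyP[Tt /negP]] := H T.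
  by rewrite -ltNge => et; exists t.
(* [V x0] may vanish, while [positive_definite_lower_bound] asks for a positive level. *)
have c0 : 0 < V x0 + 1 by rewrite ltr_wpDl// (le_trans (P_ge0 _) (V_ge_P _)).
have e2 : 0 < e / 2 by rewrite divr_gt0.
have Qc : continuous Q by case: QC1 => dQ _ y; exact: differentiable_continuous.
have [q q0 qQ] := positive_definite_lower_bound Prad Qc Qpos c0 e2.
have [r r0 Vr] := V_sublevel_bounded (V x0).
have Fc := locally_lipschitz_continuous closed_loop_locally_lipschitz.
have [M M0 FM] := continuous_bounded_ball r Fc.
(* At speed at most [M], the output moves by at most [e / 2] during [tau]; adding [1] to [M] keeps
   the denominator positive. *)
pose tau := e / (2 * (M + 1)).
have M1 : 0 < 2 * (M + 1) by rewrite mulr_gt0// ltr_wpDl.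
have tau0 : 0 < tau by rewrite divr_gt0.
have Mtau : M * tau <= e / 2.
  by rewrite /tau mulrA ler_pdivrMr//; nra.
have drop t : 0 <= t -> e < `|usubmx (phi t x0)| ->
    V (phi (t + tau) x0) <= V (phi t x0) - q * tau.
  move=> t0 et; rewrite -[tau in q * tau](addKr t) addrA [- t + t + tau]addrC.
  have -> : q * (tau + (- t + t)) = q * (t + tau - t) by ring.
  apply: V_decrease; first by rewrite t0 lerDl ltW.
  move=> s /andP[ts st]; have s0 : 0 <= s by rewrite (le_trans t0)// ltW.
  apply: qQ.
    by rewrite (le_trans (V_ge_P _))// (le_trans (V_le_initial _ s0))// lerDl.
  have : `|phi s x0 - phi t x0| <= M * (s - t).
    apply: (@mean_value_mx R _ _ (phi ^~ x0) (fun s => F (phi s x0)) t s M (ltW ts)).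
    - exact: solution_within (phiP x0) t0 (ltry _).
    - exact: solution_derive (phiP x0) t0 (ltry _).
    move=> u; rewrite in_itv /= => /andP[tu _]; apply/FM/Vr/V_le_initial.
    by rewrite (le_trans t0)// ltW.
  move=> /(le_trans (norm_usubmx_le _)); rewrite linearB /= distrC => H1.
  have H2 := le_trans (lerB_dist _ _) H1.
  have : M * (s - t) <= M * tau by rewrite ler_wpM2l// lerBlDl ltW.
  lra.
have drops m : exists2 t : R, 0 <= t & V (phi t x0) <= V x0 - m%:R * (q * tau).
  elim: m => [|m [t t0 Vt]]; first by exists 0; rewrite ?phi0 ?mul0r ?subr0.
  have [s ts es] := H t; have s0 := le_trans t0 ts.
  exists (s + tau); first by rewrite addr_ge0// ltW.
  have := drop s s0 es; have := @V_nonincreasing x0 t s; rewrite t0 ts => /(_ isT).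
  rewrite -natr1 mulrDl mul1r; lra.
have qt : 0 < q * tau by rewrite mulr_gt0.
(* More drops than [V x0 / (q * tau)] would make [V] negative. *)
have [t t0] := drops (Num.truncn (V x0 / (q * tau))).+1.
have := truncnS_gt (V x0 / (q * tau)); rewrite ltr_pdivrMr// => H1 H2.
have := le_trans (P_ge0 _) (V_ge_P (phi t x0)); lra.
Unshelve. all: by end_near. Qed.

Let Omega := [set x | V x <= gamma * L].

(** On [Omega] the function [P] itself does not increase, so an output that enters [P < q] stays
    there. While it stays at distance at least [d] from the origin, [P] falls at rate at least
    [q' / 2] from a value at most [gamma * L], which bounds the entry time uniformly. *)
Lemma flow_uniformly_attractive :
  uniformly_output_attractive phi (@usubmx R n p 1) Omega.
Proof.
move=> e r e0 r0; have [q q0 qP] := P_small e0.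
have [d d0 Pd] : exists2 d : R, 0 < d & forall y, `|y| < d -> P y < q.
  have [d d0 Pd] := continuous_dist_lt 0 Pc q0; exists d => // y yd.
  have /Pd : `|0 - y| < d by rewrite sub0r normrN.
  by case: Ppos => -> _; rewrite sub0r normrN; exact/le_lt_trans/ler_norm.
have gL : 0 < gamma * L by rewrite mulr_gt0.
have Qc : continuous Q by case: QC1 => dQ _ y; exact: differentiable_continuous.
have [q' q'0 qQ] := positive_definite_lower_bound Prad Qc Qpos gL d0.
(* Over a time [T] the guaranteed drop of [P] is [gamma * L + q' / 2]; the summand [1] makes it
   exceed [gamma * L] strictly. *)
pose T := 2 * (gamma * L) / q' + 1.
have T0 : 0 < T by rewrite ltr_wpDl// divr_ge0 ?mulr_ge0// ltW.
exists T => // x0 [_ Ox0] t Tt; apply: qP.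
have Pdec (a b c : R) : 0 <= a <= b ->
    (forall s, a < s < b -> c <= Q (usubmx (phi s x0))) ->
    P (usubmx (phi b x0)) <= P (usubmx (phi a x0)) - c / 2 * (b - a).
  move=> ab cQ; rewrite -mulNr; have a0 : 0 <= a by case/andP: ab.
  apply: (solution_diff_le (W := Py) (phiP x0)) => // [|s sab]; first exact: ltry.
  have s0 : 0 <= s by case/andP: sab => /ltW /(le_trans a0).
  apply: le_trans (Py_dot_le_half (le_trans (V_le_initial _ s0) Ox0)) _.
  by have := cQ s sab; lra.
have PL s : 0 <= s -> P (usubmx (phi s x0)) <= gamma * L.
  by move=> s0; rewrite (le_trans (V_ge_P _))// (le_trans (V_le_initial _ s0)).
have [s /andP[s0 sT] Ps] : exists2 s, 0 <= s <= T & P (usubmx (phi s x0)) < q.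
  (* Without an entry before [T], the drop over [[0, T]] would make [P] negative. *)
  apply: contrapT => H.
  have HQ s : 0 < s < T -> q' <= Q (usubmx (phi s x0)).
    move=> /andP[s0 sT]; apply: qQ; first exact/PL/ltW.
    rewrite leNgt; apply/negP => /Pd Ps; apply: H; exists s => //.
    by rewrite !ltW.
  have := Pdec 0 T q' _ HQ; rewrite lexx (ltW T0) => /(_ isT).
  have := PL 0 (lexx 0); have := P_ge0 (usubmx (phi T x0)).
  have : q' * T = 2 * (gamma * L) + q' by rewrite /T mulrDr mulr1 mulrC divfK// gt_eqF.
  lra.
(* Rate [0] in [Pdec]: after the entry time [s], monotonicity of [P] is enough. *)
apply: le_lt_trans Ps; have := Pdec s t 0 _; rewrite mul0r mul0r subr0; apply => //.
by rewrite s0 (le_trans sT).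
Qed.

Lemma flow_AOS : AOS F (@usubmx R n p 1) setT.
Proof.
exists phi; split => //; [|exact: flow_lagrange|exact: flow_lyapunov|exact: flow_attractive].
by split=> //; exact: flow_is_flow_on.
Qed.

(** [Omega] is a sublevel set of [V], which gives its positive invariance. *)
Lemma flow_UAOS : UAOS F (@usubmx R n p 1) Omega.
Proof.
exists phi; split; [|split|exact: flow_lagrange|exact: flow_lyapunov|
  exact: flow_uniformly_attractive].
- rewrite /Omega /= /V !linear0; case: Ppos => -> _.
  rewrite enorm_sqr big1 ?mulr0 ?addr0 ?mulr_ge0 ?ltW// => i _.
  by rewrite mxE expr0n.
- exact: flow_is_flow_on.
by move=> x0 t Ox0 t0; exact: le_trans (V_le_initial _ t0) Ox0.
Qed.

End Flow.

End ClosedLoop.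

Theorem theorem3 (R : realType) (n p : nat)
  (f g : 'cV[R]_n -> 'cV[R]_n) (varphi : 'cV[R]_n -> 'cV[R]_p)
  (hf : locally_lipschitz f) (hg : locally_lipschitz g)
  (hvarphi : locally_lipschitz varphi)
  (hf0 : f 0 = 0) (hvarphi0 : varphi 0 = 0)
  (P Q k : 'cV[R]_n -> R)
  (hPC2 : C2 P) (hPpos : positive_definite P) (hPrad : radially_unbounded P)
  (hQC1 : C1 Q) (hQpos : positive_definite Q)
  (hk : locally_lipschitz k) (hk0 : k 0 = 0)
  (hH : forall y, rcmul (gradient P y) (f y)
                  + rcmul (gradient P y) (g y) * k y <= - Q y)
  (mu : 'cV[R]_n -> R)
  (hmu : locally_lipschitz mu) (hmupos : forall y, 0 < mu y)
  (hA : forall y, enorm (varphi y) ^+ 2 <= mu y * Q y)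
  (gamma L : R) (hgamma : 0 < gamma) (hL : 0 < L) :
  let F := closed_loop f g varphi P k mu gamma L in
  let h := fun x : 'cV[R]_(n + p) => usubmx x in
  AOS F h setT /\
  UAOS F h [set x : 'cV[R]_(n + p) |
    P (usubmx x) + gamma / 2 * enorm (dsubmx x) ^+ 2 <= gamma * L].
Proof.
move=> F h.
have [phi phiP] := flow_exists hf hg hvarphi hk hmu hmupos hPC2 hPpos hPrad
  hQpos hH hgamma hL.
split.
  apply: flow_AOS phiP; eassumption.
apply: flow_UAOS phiP; eassumption.
Qed.
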